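(* Let $\mathcal{A}$ be a unital semisimple associative algebra over $\mathbb{C}$ graded by an abelian group $G$. Assume that for each $g\in G$, the graded component $\mathcal{A}_g$ satisfies the following two properties: (i) $1\in\mathcal{A}_g\mathcal{A}_{-g}$, (ii) $\mathcal{A}_g$ is irreducible as a (left) $\mathcal{A}_0$-module. Let $\{M_g\mid g\in G\}$ and $\{N_g\mid g\in G\}$ be thin coverings of an irreducible $\mathcal{A}$-module $M$. Then for some $h\in G$, $$\bigoplus_{g\in G}M_g\cong\bigoplus_{g\in G}N_{g-h}$$ as graded $\mathcal{A}$-modules.
   Context: Modules are left modules. $\mathcal{A}$ is semisimple if every $\mathcal{A}$-module is completely reducible. $\mathcal{A}_g\mathcal{A}_{-g}$ denotes the span of products. A ($G$-)covering of $M$ is a family of subspaces $\{M_g\mid g\in G\}$ with $\sum_gM_g=M$ and $\mathcal{A}_gM_h\subseteq M_{g+h}$ for all $g,h\in G$. It is thin if whenever $\{N_g\}$ is a covering of $M$ with $N_g\subseteq M_g$ for all $g$, then $N_g=M_g$ for all $g$. The external direct sum $\bigoplus_{g\in G}M_g$ is a $G$-graded $\mathcal{A}$-module whose degree-$g$ component is $M_g$, with $a\in\mathcal{A}_g$ mapping the component $M_{g'}$ to the component $M_{g+g'}$ by its action on $M$; in $\bigoplus_{g\in G}N_{g-h}$ the degree-$g$ component is $N_{g-h}$. *)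

(* Defs.v *)
From HB Require Import structures.
From mathcomp Require Import all_boot all_order all_algebra.
From mathcomp Require Import finmap.
From mathcomp Require Import boolp classical_sets functions cardinality fsbigop.

Set Implicit Arguments.
Unset Strict Implicit.
Unset Printing Implicit Defensive.

Import GRing.Theory.
Local Open Scope classical_set_scope.
Local Open Scope ring_scope.

Section Sums.
Variables (I : choiceType) (V : zmodType).

Definition fin_supp (f : I -> V) : Prop := finite_set (f @^-1` [set~ 0]).

(* The support condition is essential: [\sum_(i \in setT) f i] is [0] by
   convention when [f] has infinite support. *)
Definition decomposes (S : I -> set V) (f : I -> V) (v : V) : Prop :=
  [/\ forall i, S i (f i), fin_supp f & v = \sum_(i \in [set: I]) f i].

Definition is_sum (S : I -> set V) : Prop :=
  forall v, exists f, decomposes S f v.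

Definition is_direct_sum (S : I -> set V) : Prop :=
  forall v, exists! f, decomposes S f v.

End Sums.

Section Modules.
Variables (K : fieldType) (A : algType K).

(* [K] acts on an [A]-module through [c |-> c%:A]; on the regular module [A^o]
   this is the given scaling of [A], by [mulr_algl]. *)
Definition subspace (M : lmodType A) (S : set M) : Prop :=
  [/\ S 0, forall u v, S u -> S v -> S (u + v)
    & forall (c : K) v, S v -> S (c%:A *: v)].

Definition stable (M : lmodType A) (B : set A) (S : set M) : Prop :=
  forall a v, B a -> S v -> S (a *: v).

(* [S] is an irreducible [B]-module, for a subalgebra [B] of [A]. *)
Definition irreducible (M : lmodType A) (B : set A) (S : set M) : Prop :=
  [/\ subspace S, stable B S, (exists2 v, S v & v <> 0)
    & forall W : set M, subspace W -> stable B W -> W `<=` S ->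
        W = [set 0] \/ W = S].

Definition irreducible_module (M : lmodType A) : Prop :=
  @irreducible M setT setT.

Definition completely_reducible (M : lmodType A) : Prop :=
  exists (I : choiceType) (S : I -> set M),
    (forall i, irreducible setT (S i)) /\ is_direct_sum S.

Definition semisimple : Prop :=
  forall M : lmodType A, completely_reducible M.

Definition prod_span (U V : set A) : set A :=
  [set x | exists (n : nat) (c : 'I_n -> K) (a b : 'I_n -> A),
     (forall i, U (a i) /\ V (b i)) /\ x = \sum_i c i *: (a i * b i)].

End Modules.

Record grading (K : fieldType) (A : algType K) (G : zmodType) := Grading {
  gr_comp :> G -> set A;
  gr_subspace : forall g, @subspace K A A^o (gr_comp g);
  gr_direct : is_direct_sum gr_comp;
  gr_mul : forall g h a b,
    gr_comp g a -> gr_comp h b -> gr_comp (g + h) (a * b) }.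

Section Graded.
Variables (K : fieldType) (A : algType K) (G : zmodType) (AA : grading A G).

Record gradedModule := GradedModule {
  gm_sort :> lmodType A;
  gm_comp : G -> set gm_sort;
  gm_subspace : forall g, subspace (gm_comp g);
  gm_direct : is_direct_sum gm_comp;
  gm_act : forall g h a v,
    AA g a -> gm_comp h v -> gm_comp (g + h) (a *: v) }.

Definition graded_iso (E F : gradedModule) : Prop :=
  exists phi : {linear E -> F},
    bijective phi /\ forall g, phi @` (@gm_comp E g) = @gm_comp F g.

(* Families are bundled with their closure properties because [ext_dsum] below
   is only an [A]-module for such families. *)
Record covering (M : lmodType A) := Covering {
  cov_comp :> G -> set M;
  cov_subspace : forall g, subspace (cov_comp g);
  cov_sum : is_sum cov_comp;
  cov_act : forall g h a v,
    AA g a -> cov_comp h v -> cov_comp (g + h) (a *: v) }.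

Definition thin (M : lmodType A) (C : covering M) : Prop :=
  forall D : covering M,
    (forall g, D g `<=` C g) -> forall g, D g = C g.

End Graded.

Section Shift.
Variables (K : fieldType) (A : algType K) (G : zmodType) (AA : grading A G).
Variables (M : lmodType A) (C : covering AA M) (h : G).

Definition shift_comp (g : G) : set M := C (g - h).

Lemma shift_sum : is_sum shift_comp.
Proof.
move=> v; have [f [fC ff ->]] := cov_sum C v.
have bij : bijective (fun g : G => g - h).
  by exists (fun g => g + h) => g; rewrite ?subrK ?addrK.
exists (fun g => f (g - h)); split; first by move=> g; exact: fC.
- rewrite /fin_supp.
  have -> : (fun g => f (g - h)) @^-1` [set~ 0] =
            (fun g => g + h) @` (f @^-1` [set~ 0]).
    apply/seteqP; split=> g /=.
      by move=> fg; exists (g - h); rewrite ?subrK.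
    by move=> [k fk <-]; rewrite addrK.
  exact: finite_image.
- exact: reindex_fsbigT.
Qed.

Lemma shift_act g k a v : AA g a -> shift_comp k v -> shift_comp (g + k) (a *: v).
Proof. by rewrite /shift_comp -addrA => Aa Cv; exact: cov_act. Qed.

Definition shift : covering AA M :=
  Covering (fun g => cov_subspace C (g - h)) shift_sum shift_act.

End Shift.

Section Decompositions.
Variables (I : choiceType) (V : zmodType).
Implicit Types (f : I -> V) (S : I -> set V).

Lemma fin_suppP f :
  fin_supp f <-> exists X : {fset I}, forall i, i \notin X -> f i = 0.
Proof.
split=> [ff|[X fX]].
  exists (fset_set (f @^-1` [set~ 0])) => i.
  by rewrite in_fset_set// notin_setE /= => /contrapT.
apply: (sub_finite_set _ (finite_fset X)) => i /= fi.
by apply/negPn/negP => /fX.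
Qed.

Lemma fin_supp0 : fin_supp (fun _ : I => 0 : V).
Proof. by apply/fin_suppP; exists fset0. Qed.

Lemma fin_suppB f f' :
  fin_supp f -> fin_supp f' -> fin_supp (fun i => f i - f' i).
Proof.
move=> /fin_suppP[X fX] /fin_suppP[Y fY]; apply/fin_suppP.
exists (X `|` Y)%fset => i; rewrite inE negb_or => /andP[iX iY].
by rewrite fX// fY// subr0.
Qed.

Lemma fsumD f f' : fin_supp f -> fin_supp f' ->
  \sum_(i \in [set: I]) (f i + f' i) =
  \sum_(i \in [set: I]) f i + \sum_(i \in [set: I]) f' i.
Proof.
move=> /fin_suppP[X fX] /fin_suppP[Y fY].
have hX i : i \notin (X `|` Y)%fset -> f i = 0.
  by rewrite inE negb_or => /andP[/fX].
have hY i : i \notin (X `|` Y)%fset -> f' i = 0.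
  by rewrite inE negb_or => /andP[_ /fY].
rewrite (fsbigTE _ _ hX) (fsbigTE _ _ hY) -big_split; apply: (fsbigTE (X `|` Y)%fset) => i Xi.
by rewrite hX// hY// addr0.
Qed.

Definition delta (i : I) (v : V) (j : I) : V := if j == i then v else 0.

Lemma fin_supp_delta i v : fin_supp (delta i v).
Proof.
by apply/fin_suppP; exists [fset i]%fset => j; rewrite inE /delta => /negPf->.
Qed.

Lemma fsum_delta i v : \sum_(j \in [set: I]) delta i v j = v.
Proof.
rewrite (@fsbigTE _ _ _ _ [fset i]%fset) => [|j].
  by rewrite big_seq_fset1 /delta eqxx.
by rewrite inE /delta => /negPf->.
Qed.

End Decompositions.

Section Components.
Variables (K : fieldType) (A : algType K) (G : zmodType) (AA : grading A G).
Implicit Types (a b : A) (g h : G).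

Definition hcomp (a : A) (g : G) : A := projT1 (cid (gr_direct AA a)) g.

Lemma hcompP a : decomposes AA (hcomp a) a.
Proof. by case: (projT2 (cid (gr_direct AA a))). Qed.

Lemma hcomp_uniq a f : decomposes AA f a -> hcomp a = f.
Proof. by case: (projT2 (cid (gr_direct AA a))) => _; apply. Qed.

Lemma gr0 g : AA g 0. Proof. by case: (gr_subspace AA g). Qed.

Lemma grD g a b : AA g a -> AA g b -> AA g (a + b).
Proof. by case: (gr_subspace AA g) => _ + _; apply. Qed.

Lemma grZ g (c : K) a : AA g a -> AA g (c *: a).
Proof.
by move=> ga; rewrite -mulr_algl; case: (gr_subspace AA g) => _ _; apply.
Qed.

Lemma hcompD a b g : hcomp (a + b) g = hcomp a g + hcomp b g.
Proof.
have [ha fa ea] := hcompP a; have [hb fb eb] := hcompP b.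
suff /hcomp_uniq -> : decomposes AA (fun g => hcomp a g + hcomp b g) (a + b) by [].
split=> [k||]; first exact: grD.
- move/fin_suppP: fa => [X fX]; move/fin_suppP: fb => [Y fY].
  apply/fin_suppP; exists (X `|` Y)%fset => i; rewrite inE negb_or.
  by case/andP=> iX iY; rewrite fX// fY// addr0.
- by rewrite fsumD// -ea -eb.
Qed.

Lemma hcomp_hom g a : AA g a -> hcomp a = delta g a.
Proof.
move=> ga; apply: hcomp_uniq; split=> [k||].
- by rewrite /delta; case: eqP => [->//|_]; exact: gr0.
- exact: fin_supp_delta.
- by rewrite fsum_delta.
Qed.

Lemma gr_ind (P : A -> Prop) :
  P 0 -> (forall a b, P a -> P b -> P (a + b)) ->
  (forall g a, AA g a -> P a) -> forall a, P a.
Proof.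
move=> P0 PD Ph a; have [ha /fin_suppP[X fX] ->] := hcompP a.
rewrite (fsbigTE _ _ fX); elim/big_ind: _ => // g _; exact: (Ph g).
Qed.

Lemma hcomp_fsum (I : seq G) (F : G -> A) g :
  hcomp (\sum_(i <- I) F i) g = \sum_(i <- I) hcomp (F i) g.
Proof.
have h0 : hcomp 0 g = 0.
  by rewrite (hcomp_hom (gr0 0)) /delta; case: ifP.
by elim: I => [|i I IH]; rewrite ?big_nil ?big_cons// hcompD IH.
Qed.

Lemma gr1 : AA 0 1.
Proof.
have [h1 /fin_suppP[X fX] e1] := hcompP 1.
rewrite (fsbigTE _ _ fX) in e1.
have hom g a : AA g a -> a * hcomp 1 0 = a.
  move=> ga; have ea : a = \sum_(i <- X) a * hcomp 1 i.
    by rewrite -mulr_sumr -e1 mulr1.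
  have := hcomp_hom ga => /(congr1 (@^~ g)); rewrite /delta eqxx => <-.
  rewrite {2}ea hcomp_fsum.
  have E i : hcomp (a * hcomp 1 i) g = delta 0 (a * hcomp 1 0) i.
    rewrite (hcomp_hom (gr_mul ga (h1 i))) /delta -{1}(addr0 g).
    by rewrite (inj_eq (addrI g)) eq_sym; case: eqP => // ->.
  rewrite (eq_bigr _ (fun i _ => E i)) (hcomp_hom ga) /delta eqxx.
  case: (boolP (0 \in X)) => X0.
    rewrite (big_fsetD1 0)//= eqxx big1_fset ?addr0// => i.
    by rewrite !inE => /andP[/negPf->].
  by rewrite fX// mulr0 big1// => i _; case: ifP.
have all a : a * hcomp 1 0 = a.
  elim/gr_ind: a => [|a b|g a]; first by rewrite mul0r.
    by rewrite mulrDl => -> ->.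
  exact: hom.
by rewrite -[1]all mul1r; exact: h1.
Qed.

End Components.

Section ExternalSum.
Variables (K : fieldType) (A : algType K) (G : zmodType) (AA : grading A G).
Variables (M : lmodType A) (C : covering AA M).
Implicit Types (a b : A) (f : G -> M).

Definition dsum_pred : {pred G -> M} :=
  fun f => `[< fin_supp f /\ forall g, C g (f g) >].

Record dsum : Type := DSum { dsum_val :> G -> M; _ : dsum_val \in dsum_pred }.

HB.instance Definition _ := [isSub for dsum_val].
HB.instance Definition _ := [Choice of dsum by <:].

Lemma dsum_predP f :
  reflect (fin_supp f /\ forall g, C g (f g)) (f \in dsum_pred).
Proof. exact: asboolP. Qed.

Lemma cov0 g : C g 0. Proof. by case: (cov_subspace C g). Qed.

Lemma covD g u v : C g u -> C g v -> C g (u + v).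
Proof. by case: (cov_subspace C g) => _ + _; apply. Qed.

Lemma covZ g (c : K) v : C g v -> C g (c%:A *: v).
Proof. by case: (cov_subspace C g) => _ _; apply. Qed.

Lemma covN g v : C g v -> C g (- v).
Proof. by move=> /(covZ (-1)); rewrite !scaleN1r. Qed.

Lemma dsum_zmod_closed : zmod_closed dsum_pred.
Proof.
split=> [|f f' /dsum_predP[ff fC] /dsum_predP[ff' fC']]; apply/dsum_predP.
  by split=> [|g]; [exact: fin_supp0 | exact: cov0].
by split=> [|g]; [exact: fin_suppB | apply: covD => //; exact: covN].
Qed.

HB.instance Definition _ := GRing.isZmodClosed.Build _ dsum_pred dsum_zmod_closed.
HB.instance Definition _ := [SubChoice_isSubZmodule of dsum by <:].

(* For homogeneous [a] of degree [g], [act a f k = a *: f (k - g)]: the entry of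
   [f] in degree [g'] is sent to degree [g + g'] (see [act_hom]). *)
Definition act (a : A) (f : G -> M) (k : G) : M :=
  \sum_(g \in [set: G]) hcomp AA a g *: f (k - g).

Lemma fin_supp_act a (f : G -> M) k : fin_supp (fun g => hcomp AA a g *: f (k - g)).
Proof.
have [_ /fin_suppP[X fX] _] := hcompP AA a.
by apply/fin_suppP; exists X => g /fX->; rewrite scale0r.
Qed.

Lemma actDl a b f : act (a + b) f = act a f + act b f.
Proof.
apply/funext => k; change ((act a f + act b f) k) with (act a f k + act b f k).
rewrite /act -fsumD; try exact: fin_supp_act.
by apply: eq_fsbigr => g _; rewrite hcompD scalerDl.
Qed.

Lemma actDr a f f' : act a (f + f') = act a f + act a f'.
Proof.
apply/funext => k; change ((act a f + act a f') k) with (act a f k + act a f' k).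
rewrite /act -fsumD; try exact: fin_supp_act.
by apply: eq_fsbigr => g _; rewrite -scalerDr.
Qed.

Lemma act_hom g a f k : AA g a -> act a f k = a *: f (k - g).
Proof.
move=> ga; rewrite /act (hcomp_hom ga) -[RHS](fsum_delta g).
by apply: eq_fsbigr => i _; rewrite /delta; case: eqP => [->//|]; rewrite scale0r.
Qed.

Lemma act0l f : act 0 f = 0.
Proof. by apply/funext => k; rewrite (act_hom _ _ (gr0 AA 0)) scale0r. Qed.

Lemma act0r a : act a 0 = 0.
Proof. by apply: (addrI (act a 0)); rewrite -actDr !addr0. Qed.

Lemma act1 f : act 1 f = f.
Proof.
by apply/funext => k; rewrite (act_hom _ _ (gr1 AA)) scale1r subr0.
Qed.

Lemma actA a b f : act a (act b f) = act (a * b) f.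
Proof.
elim/(gr_ind (AA := AA)): a => [|a a' IH IH'|g a ga]; first by rewrite mul0r !act0l.
  by rewrite mulrDl !actDl IH IH'.
elim/(gr_ind (AA := AA)): b => [|b b' IH IH'|h b hb].
- by rewrite mulr0 !act0l act0r.
- by rewrite mulrDr !actDl actDr IH IH'.
apply/funext => k.
rewrite (act_hom _ _ ga) (act_hom _ _ hb) (act_hom _ _ (gr_mul ga hb)).
by rewrite scalerA opprD addrA.
Qed.

Lemma act_dsum a (f : dsum) : act a f \in dsum_pred.
Proof.
elim/(gr_ind (AA := AA)): a => [|a a' IH IH'|g a ga]; first by rewrite act0l rpred0.
  by rewrite actDl rpredD.
case: f => f /= /dsum_predP[/fin_suppP[X fX] fC]; apply/dsum_predP; split.
  apply/fin_suppP; exists [fset (g + i)%R | i in X]%fset => k kX.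
  rewrite (act_hom _ _ ga) fX ?scaler0//; apply: contra kX => kX.
  by apply/imfsetP; exists (k - g) => //; rewrite addrC subrK.
move=> k; rewrite (act_hom _ _ ga) -[k in C k](subrK g) addrC.
exact: cov_act.
Qed.

Definition dsum_scale (a : A) (f : dsum) : dsum := DSum (act_dsum a f).

Lemma dsum_scaleA a b (f : dsum) : dsum_scale a (dsum_scale b f) = dsum_scale (a * b) f.
Proof. by apply/val_inj; rewrite /= actA. Qed.

Lemma dsum_scale1 : left_id 1 dsum_scale.
Proof. by move=> f; apply/val_inj; rewrite /= act1. Qed.

Lemma dsum_scaleDr : right_distributive dsum_scale +%R.
Proof. by move=> a f f'; apply/val_inj; rewrite /= actDr. Qed.

Lemma dsum_scaleDl (f : dsum) : {morph dsum_scale^~ f : a b / a + b}.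
Proof. by move=> a b; apply/val_inj; rewrite /= actDl. Qed.

HB.instance Definition _ := GRing.Zmodule_isLmodule.Build A dsum
  dsum_scaleA dsum_scale1 dsum_scaleDr dsum_scaleDl.

Definition dsum_comp (g : G) : set dsum :=
  [set f : dsum | forall k, k <> g -> f k = 0].

Lemma dsum_act g h a (f : dsum) :
  AA g a -> dsum_comp h f -> dsum_comp (g + h) (a *: f).
Proof.
move=> ga fh k kgh; rewrite /GRing.scale /= (act_hom _ _ ga) fh ?scaler0//.
by move=> e; apply: kgh; rewrite -e addrC subrK.
Qed.

Lemma dsum_subspace g : subspace (dsum_comp g).
Proof.
split=> [k _//|f f' fg fg' k kg|c f fg].
  transitivity (f k + f' k); first by [].
  by rewrite fg ?fg' ?addr0.
by rewrite -[g]add0r; apply: dsum_act => //; apply: grZ; exact: gr1.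
Qed.

Lemma dsum_deltaP (f : dsum) g : delta g (f g) \in dsum_pred.
Proof.
case: f => f /= /dsum_predP[ff fC]; apply/dsum_predP; split.
  exact: fin_supp_delta.
by move=> k; rewrite /delta; case: eqP => [->//|_]; exact: cov0.
Qed.

Lemma dsum_direct : is_direct_sum dsum_comp.
Proof.
have sumE (X : seq G) (F : G -> dsum) k :
    dsum_val (\sum_(i <- X) F i) k = \sum_(i <- X) F i k.
  elim: X => [|i X IH]; first by rewrite !big_nil.
  by rewrite !big_cons -IH.
have fsumE F k : fin_supp F -> (forall i, dsum_comp i (F i)) ->
    dsum_val (\sum_(i \in [set: G]) F i) k = F k k.
  move=> /fin_suppP[X FX] FC; rewrite (fsbigTE _ _ FX) sumE.
  rewrite -[RHS](fsum_delta k) [RHS](@fsbigTE _ _ _ _ X) => [|i iX].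
    apply: eq_bigr => i _; rewrite /delta; case: eqP => [->//|ik].
    by rewrite FC// => ki; apply: ik.
  by rewrite /delta; case: eqP => [<-|//]; rewrite FX.
move=> f; have ff : fin_supp f by case: f => f /= /dsum_predP[].
pose F g := DSum (dsum_deltaP f g).
have FC i : dsum_comp i (F i).
  by move=> k /= /eqP/negPf ki; rewrite /delta ki.
have fF : fin_supp F.
  move/fin_suppP: ff => [X fX]; apply/fin_suppP; exists X => g /fX fg.
  by apply/val_inj/funext => k; rewrite /= /delta fg; case: ifP.
exists F; split; first split=> //.
  by apply/val_inj/funext => k; rewrite /= fsumE// /= /delta eqxx.
move=> F' [FC' fF' ef]; apply/funext => g; apply/val_inj/funext => k.
by rewrite /= /delta ef fsumE//; case: eqP => [->//|kg]; rewrite FC'.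
Qed.

Definition ext_dsum : gradedModule AA :=
  GradedModule dsum_subspace dsum_direct dsum_act.

End ExternalSum.

(* Main.v *)
Require Import Defs.
From HB Require Import structures.
From mathcomp Require Import all_boot all_order all_algebra.
From mathcomp Require Import finmap boolp functions fsbigop.
From mathcomp Require Import classical_sets reals complex.

Set Implicit Arguments.
Unset Strict Implicit.
Unset Printing Implicit Defensive.

Import GRing.Theory.
Local Open Scope ring_scope.

(** Every thin covering [C] of [M] is a copy of the regular module: the graded
    module [ext_dsum C] is isomorphic to [A] itself, graded by [AA].  A shift
    of a thin covering is again thin, so the external sums of any two thin
    coverings, shifted or not, are isomorphic through the regular module; the
    theorem follows with [h = 0].

    Here is why.  Since [1] lies in [A_g A_{-g}], a vector killed by all of
    [A_{-g}] is zero ([prod_span_eq0]).  Hence [C 0] contains some [m != 0]: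
    otherwise [A_{-g}] would kill [C g] for every [g], and [M] would be zero
    ([cov_comp0_neq0]).  As [M] is irreducible, [A m = M], so the subspaces
    [A_g m] form a covering, which is contained in [C] because [m] is in [C 0];
    thinness then gives [C g = A_g m] for all [g] ([thin_orbit]).  Finally
    [a |-> a m] is injective on each [A_g]: the elements of [A_g] that kill [m]
    form an [A_0]-submodule of the irreducible [A_g], and it cannot be all of
    [A_g], for then [m] would be zero ([comp_ann0]).  So acting on [m] placed in
    degree [0] maps [A_g] bijectively onto the degree-[g] component of
    [ext_dsum C], for every [g], and it is an isomorphism because both sides
    are direct sums of their components ([graded_iso_components]). *)

(** * Graded isomorphisms *)

Section GradedIso.
Variables (K : fieldType) (A : algType K) (G : zmodType) (AA : grading A G).
Implicit Types E F : gradedModule AA.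

Lemma fin_supp_comp E F (phi : {linear E -> F}) (f : G -> E) :
  fin_supp f -> fin_supp (phi \o f).
Proof.
by move=> /fin_suppP[X fX]; apply/fin_suppP; exists X => i /fX /= ->; rewrite linear0.
Qed.

Lemma linear_fsum E F (phi : {linear E -> F}) (f : G -> E) : fin_supp f ->
  phi (\sum_(g \in [set: G]) f g) = \sum_(g \in [set: G]) phi (f g).
Proof.
move=> /fin_suppP[X fX]; rewrite (fsbigTE _ _ fX) linear_sum.
by rewrite (@fsbigTE _ _ _ _ X)// => i /fX ->; rewrite linear0.
Qed.

(** Uniqueness of decompositions in [F] turns injectivity on each component into
    injectivity on [E]; existence of decompositions in [F] gives surjectivity,
    by lifting one homogeneous part at a time. *)
Lemma graded_iso_components E F (phi : {linear E -> F}) :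
  (forall g, phi @` gm_comp (g0 := E) g = gm_comp (g0 := F) g)%classic ->
  (forall g v, gm_comp (g0 := E) g v -> phi v = 0 -> v = 0) ->
  graded_iso E F.
Proof.
move=> imphi kerphi; exists phi; split=> //; rewrite -setTT_bijective; split=> //.
- move=> u v _ _ euv; apply/eqP; rewrite -subr_eq0; apply/eqP.
  have phi0 : phi (u - v) = 0 by rewrite linearB euv subrr.
  have [f [[fE ff ev] _]] := gm_direct (u - v).
  have [z [_ uniq0]] := gm_direct (0 : F).
  have phif : phi \o f = fun=> 0.
    transitivity z; [symmetry|]; apply: uniq0; split.
    + by move=> g; rewrite -imphi; exists (f g).
    + exact: fin_supp_comp.
    + by rewrite -linear_fsum// -ev phi0.
    + by move=> g; case: (@gm_subspace _ _ _ _ F g).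
    + exact: fin_supp0.
    + by rewrite fsbig1.
  rewrite ev fsbig1// => g _; apply: (kerphi g) => //.
  by have := congr1 (@^~ g) phif.
- move=> w _; have [f [[fF ff ->] _]] := gm_direct w.
  (* The last clause keeps the support of the chosen preimages finite. *)
  have lift g : exists v, gm_comp (g0 := E) g v /\ phi v = f g /\ (f g = 0 -> v = 0).
    have := fF g; rewrite -imphi => -[v Ev <-]; exists v; split=> //; split=> //.
    by apply: (kerphi g).
  have [k kP] := choice lift.
  have fk : fin_supp k.
    case/fin_suppP: ff => X fX; apply/fin_suppP; exists X => g /fX fg0.
    by case: (kP g) => _ [_ ->].
  exists (\sum_(g \in [set: G]) k g)=> //; rewrite linear_fsum//.
  by apply: eq_fsbigr => g _; case: (kP g) => _ [].
Qed.

Lemma graded_iso_sym E F : graded_iso E F -> graded_iso F E.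
Proof.
case=> phi [[psi phiK psiK] imphi].
have psi_lin : linear psi by exact: can2_linear phiK psiK.
pose psiL : {linear F -> E} :=
  HB.pack psi (GRing.isLinear.Build A F E *:%R psi psi_lin).
exists psiL; split; first by exists phi.
move=> g; rewrite -imphi; apply/seteqP; split=> [_ [_ [u Eu <-] <-]|u Eu] /=.
  by rewrite phiK.
by exists (phi u); [exists u | exact: phiK].
Qed.

Lemma graded_iso_trans E F H : graded_iso E F -> graded_iso F H -> graded_iso E H.
Proof.
case=> phi [bij_phi imphi] [psi [bij_psi impsi]].
exists (psi \o phi : {linear E -> H}); split; first exact: bij_comp.
by move=> g; rewrite -impsi -imphi image_comp.
Qed.

End GradedIso.

(** * The regular module and the orbit of a vector *)

Section Orbit.
Variables (K : fieldType) (A : algType K) (G : zmodType) (AA : grading A G).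

Definition regular : gradedModule AA :=
  @GradedModule K A G AA A^o AA (gr_subspace AA) (gr_direct AA)
    (@gr_mul K A G AA).

Section OrbitMap.
Variables (E : gradedModule AA) (e : E).

Definition orbit_map (a : regular) : E := (a : A) *: e.

Fact orbit_map_is_linear : linear orbit_map.
Proof. by move=> a b c; rewrite /orbit_map scalerDl scalerA. Qed.

HB.instance Definition _ :=
  GRing.isLinear.Build A regular E *:%R orbit_map orbit_map_is_linear.

(** The first hypothesis forces [e] to have degree [0], since [1] does. *)
Lemma regular_iso_orbit :
  (forall g, [set a *: e | a in AA g]%classic = gm_comp (g0 := E) g) ->
  (forall g a, AA g a -> a *: e = 0 -> a = 0) ->
  graded_iso regular E.
Proof. exact: (graded_iso_components (phi := orbit_map)). Qed.

End OrbitMap.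

Variable M : lmodType A.

(** Expanding [v = 1 *: v] along products [a_i * b_i] leaves only terms
    [a_i *: (b_i *: v)] with [b_i] in [V].  With [U = A_g] and [V = A_{-g}],
    this is how the hypothesis [1 \in A_g A_{-g}] enters the proof. *)
Lemma prod_span_eq0 (U V : set A) (v : M) :
  prod_span U V 1 -> (forall b, V b -> b *: v = 0) -> v = 0.
Proof.
case=> n [c [a [b [ab e1]]]] Vv; rewrite -[v]scale1r e1 scaler_suml big1// => i _.
by rewrite -mulr_algl -!scalerA Vv ?scaler0//; case: (ab i).
Qed.

Lemma irreducible_cyclic (m : M) :
  irreducible_module M -> m <> 0 -> forall v : M, exists a : A, v = a *: m.
Proof.
move=> [_ _ _ minM] m0.
pose W : set M := [set v | exists a : A, v = a *: m]%classic.
have Wm : W m by exists 1; rewrite scale1r.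
have subW : subspace W.
  split=> [|_ _ [a ->] [b ->]|c _ [a ->]]; first by exists 0; rewrite scale0r.
    by exists (a + b); rewrite scalerDl.
  by exists (c%:A * a); rewrite scalerA.
have stW : stable setT W by move=> a _ _ [b ->]; exists (a * b); rewrite scalerA.
have [//|W0|WT] := minM W subW stW; first by move: Wm; rewrite W0.
by move=> v; have : W v by rewrite WT.
Qed.

Section OrbitCovering.
Variables (m : M) (cyc : forall v : M, exists a : A, v = a *: m).

Definition orbit_comp (g : G) : set M := [set a *: m | a in AA g]%classic.

Lemma orbit_subspace g : subspace (orbit_comp g).
Proof.
split=> [|_ _ [a ga <-] [b gb <-]|c _ [a ga <-]].
- by exists 0; [exact: gr0 | rewrite scale0r].
- by exists (a + b); [exact: grD | rewrite scalerDl].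
- by exists (c *: a); [exact: grZ | rewrite scalerA mulr_algl].
Qed.

Lemma orbit_sum : is_sum orbit_comp.
Proof.
move=> v; have [a ->] := cyc v; have [homa /fin_suppP[X aX] ea] := hcompP AA a.
have aX' g : g \notin X -> hcomp AA a g *: m = 0 by move=> /aX ->; rewrite scale0r.
exists (fun g => hcomp AA a g *: m); split.
- by move=> g; exists (hcomp AA a g).
- by apply/fin_suppP; exists X.
- by rewrite {1}ea (fsbigTE _ _ aX) (fsbigTE _ _ aX') scaler_suml.
Qed.

Lemma orbit_act g h a v : AA g a -> orbit_comp h v -> orbit_comp (g + h) (a *: v).
Proof.
by move=> ga [b hb <-]; exists (a * b); [exact: gr_mul | rewrite scalerA].
Qed.

Definition orbit_covering : covering AA M :=
  Covering orbit_subspace orbit_sum orbit_act.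

End OrbitCovering.

(** As [C] is stable under [A_g] and [m] has degree [0], the covering by the
    [A_g m] lies inside [C]; thinness makes the two equal. *)
Lemma thin_orbit (C : covering AA M) (m : M) :
  thin C -> C 0 m -> (forall v : M, exists a : A, v = a *: m) ->
  forall g, [set a *: m | a in AA g]%classic = C g.
Proof.
move=> thinC Cm cyc; apply: (thinC (orbit_covering cyc)) => g _ [a ga <-].
by rewrite -[g]addr0; exact: cov_act.
Qed.

End Orbit.

(** * Thin coverings *)

Section Thin.
Variables (K : fieldType) (A : algType K) (G : zmodType) (AA : grading A G).
Variable M : lmodType A.
Hypothesis unit_prod : forall g : G, prod_span (AA g) (AA (- g)) 1.

(** Acting with [A_{-g}] brings [C g] into [C 0]; if [C 0] were zero, each [C g]
    would be killed by [A_{-g}], hence zero, and so would be their sum [M]. *)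
Lemma cov_comp0_neq0 (C : covering AA M) :
  (exists v : M, v <> 0) -> exists2 m, C 0 m & m <> 0.
Proof.
case=> v v0; apply: contrapT => noC0.
have C0 m : C 0 m -> m = 0.
  by move=> Cm; apply: contrapT => m0; apply: noC0; exists m.
have Cg g w : C g w -> w = 0.
  move=> Cw; apply: (prod_span_eq0 (unit_prod g)) => b gb.
  by apply: C0; rewrite -(addNr g); exact: cov_act.
have [f [fC _ ev]] := cov_sum C v.
by apply: v0; rewrite ev fsbig1// => g _; exact: (Cg g).
Qed.

(** The annihilator of [m] in [A_g] is an [A_0]-submodule of an irreducible
    module, so it is [0] or [A_g]; the second case contradicts
    [1 \in A_{-g} A_g]. *)
Lemma comp_ann0 (m : M) g :
  irreducible (AA 0) (AA g : set A^o) -> m <> 0 ->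
  forall a, AA g a -> a *: m = 0 -> a = 0.
Proof.
move=> [_ _ _ minAg] m0 a ga am0.
pose W : set A^o := [set x : A^o | AA g x /\ (x : A) *: m = 0]%classic.
have subW : subspace W.
  split=> [|x y [gx x0] [gy y0]|c x [gx x0]].
  - by split; [exact: gr0 | rewrite scale0r].
  - by split; [exact: grD | rewrite scalerDl x0 y0 addr0].
  - split; last by rewrite -scalerA x0 scaler0.
    by rewrite -[g]add0r; apply: gr_mul => //; apply: grZ; exact: gr1.
have stW : stable (AA 0) W.
  move=> b x b0 [gx x0]; split; last by rewrite -scalerA x0 scaler0.
  by rewrite -[g]add0r; exact: gr_mul.
have Wa : W a by [].
have [x []//|W0|Wg] := minAg W subW stW; first by move: Wa; rewrite W0.
case: m0; apply: (prod_span_eq0 (unit_prod (- g))) => b; rewrite opprK -Wg.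
by case.
Qed.

(** The isomorphism is [a |-> a *: e], where [e] is a nonzero vector [m] of [C 0]
    placed in degree [0]: it sends [a] of degree [g] to [a *: m] placed in
    degree [g]. *)
Lemma regular_iso_thin (C : covering AA M) :
  (forall g : G, irreducible (AA 0) (AA g : set A^o)) ->
  irreducible_module M -> thin C -> graded_iso (regular AA) (ext_dsum C).
Proof.
move=> irrA irrM thinC.
have [|m Cm m0] := cov_comp0_neq0 C; first by case: irrM => _ _ [v _ v0] _; exists v.
have Cgen := thin_orbit thinC Cm (irreducible_cyclic irrM m0).
have dm : delta 0 m \in dsum_pred C.
  apply/dsum_predP; split; first exact: fin_supp_delta.
  by move=> g; rewrite /delta; case: eqP => [->//|_]; exact: cov0.
pose e : ext_dsum C := DSum dm.
have eE g a : AA g a -> dsum_val (a *: e) = delta g (a *: m).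
  move=> ga; apply/funext => k; rewrite /= (act_hom _ _ ga) /delta subr_eq0.
  by case: eqP => // _; rewrite scaler0.
apply: (regular_iso_orbit (e := e)) => [g|g a ga ea0].
- apply/seteqP; split=> [_ [a ga <-]|f fg].
    by move=> k /eqP/negPf kg; rewrite (eE g a ga) /delta kg.
  have [_ fC] : fin_supp (dsum_val f) /\ forall g, C g (dsum_val f g).
    by case: (f) => f' /= /dsum_predP.
  have := fC g; rewrite -Cgen => -[a ga af]; exists a => //.
  apply/val_inj/funext => k; rewrite [LHS](congr1 (@^~ k) (eE g a ga)) /delta.
  by case: eqP => [->//|/fg].
- apply: (comp_ann0 (irrA g) m0 ga).
  by have := congr1 (@^~ g) (eE g a ga); rewrite ea0 /delta eqxx.
Qed.

(** A covering inside [shift C h] becomes, once shifted back by [- h], a covering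
    inside [C]. *)
Lemma thin_shift (C : covering AA M) h : thin C -> thin (shift C h).
Proof.
move=> thinC D DC g.
have /thinC DE k : (shift D (- h) k `<=` C k)%classic.
  by move=> v /DC; rewrite /= /shift_comp opprK addrK.
by have := DE (g - h); rewrite /= /shift_comp opprK subrK.
Qed.

End Thin.

Theorem theorem2p2 (R : realType) (A : algType R[i]) (G : zmodType)
    (AA : grading A G)
    (semisimple_A : semisimple A)
    (unit_prod : forall g : G, prod_span (AA g) (AA (- g)) 1)
    (irr_comp : forall g : G, irreducible (AA 0) (AA g : set A^o))
    (M : lmodType A) (irr_M : irreducible_module M)
    (Mc Nc : covering AA M) (thin_Mc : thin Mc) (thin_Nc : thin Nc) :
  exists h : G, graded_iso (ext_dsum Mc) (ext_dsum (shift Nc h)).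
Proof.
exists 0; apply: (graded_iso_trans (F := regular AA)).
  by apply: graded_iso_sym; exact: regular_iso_thin.
by apply: regular_iso_thin => //; exact: thin_shift.
Qed.
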